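(* Let $A$ be an integral domain and $E$ a factorial $A$-module which is not a second module. Then the quasi divisor topology $qD_A(E)$ is homeomorphic to the divisor topology $D(A)$ on the integral domain $A$. In particular, the two topologies are the same.
   Context: For an $A$-module $E$: $\operatorname{ann}(E)=\{a\in A: aE=0\}$, $W(E)=\{a\in A: aE\neq E\}$, $W(E)^{\#}=W(E)\setminus\operatorname{ann}(E)$. On $W(E)^{\#}$ put $a\sim b$ iff $aE=bE$; $[a]$ is the class of $a$ and $\operatorname{EC}(W(E)^{\#})$ is the set of all classes. For $a\in W(E)^{\#}$, $U_a=\{[b]\in\operatorname{EC}(W(E)^{\#}): aE\subseteq bE\}$. The quasi divisor topology $qD_A(E)$ is the topological space $\operatorname{EC}(W(E)^{\#})$ whose topology has basis $\{U_a\}_{a\in W(E)^{\#}}$. The divisor topology $D(A)$: let $A^{\#}$ be the set of nonzero nonunits of $A$, with $a\sim b$ iff $aA=bA$; $D(A)$ is the set $\operatorname{EC}(A^{\#})$ of classes with the topology having as basis the sets $\{[b]\in\operatorname{EC}(A^{\#}): b\mid a\}$, $a\in A^{\#}$. $E$ is second if for every $a\in A$ either $aE=E$ or $aE=0$. An element $m\in E$ is irreducible in $E$ if it has no proper factor, i.e. $m=am'$ with $a\in A$, $m'\in E$ implies $a$ is a unit. An element $a\in A$ is prime to $E$ if $a$ is irreducible in $A$ and, whenever $a$ divides $bm$ in $E$ ($b\in A$, $m\in E$; i.e. $bm\in aE$), either $a\mid b$ in $A$ or $m\in aE$. A torsion free $A$-module $E$ is factorial if every nonzero $m\in E$ has an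 irreducible factorization $m=a_1\cdots a_n m'$ ($a_i$ irreducible in $A$, $m'$ irreducible in $E$), unique up to order and associates. It is known that if $E$ is a factorial $A$-module then $A$ is a UFD and every irreducible element of $A$ is prime to $E$. *)

(* Defs.v *)
From HB Require Import structures.
From mathcomp Require Import all_boot all_algebra.
From mathcomp Require Import all_classical topology.

Set Implicit Arguments.
Unset Strict Implicit.
Unset Printing Implicit Defensive.

Import GRing.Theory.
Local Open Scope classical_set_scope.
Local Open Scope ring_scope.

Definition divides (A : idomainType) (b a : A) : Prop := exists c : A, a = b * c.

Definition associates (A : idomainType) (a b : A) : Prop :=
  exists2 u : A, u \is a GRing.unit & b = u * a.

Definition irreducible (A : idomainType) (a : A) : Prop :=
  [/\ a != 0, a \isn't a GRing.unit &
      forall b c : A, a = b * c -> b \is a GRing.unit \/ c \is a GRing.unit].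

Definition principal (A : idomainType) (a : A) : set A :=
  range (fun c : A => a * c).

Definition scaled (A : idomainType) (E : lmodType A) (a : A) : set E :=
  range (fun m : E => a *: m).
Arguments scaled {A} E a _.

Definition ann (A : idomainType) (E : lmodType A) : set A :=
  [set a | scaled E a = [set 0]].

Definition W (A : idomainType) (E : lmodType A) : set A :=
  [set a | scaled E a <> setT].

Definition Wsharp (A : idomainType) (E : lmodType A) : set A := W E `\` ann E.

(* With this definition the zero module is second. *)
Definition second (A : idomainType) (E : lmodType A) : Prop :=
  forall a : A, scaled E a = setT \/ scaled E a = [set 0].

Definition torsion_free (A : idomainType) (E : lmodType A) : Prop :=
  forall (a : A) (m : E), a *: m = 0 -> a = 0 \/ m = 0.

Definition irreducible_in (A : idomainType) (E : lmodType A) (m : E) : Prop :=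
  forall (a : A) (m' : E), m = a *: m' -> a \is a GRing.unit.

Definition associates_in (A : idomainType) (E : lmodType A) (m m' : E) : Prop :=
  exists2 u : A, u \is a GRing.unit & m' = u *: m.

(* m = a_1 ... a_n m' with s = [:: a_1; ...; a_n]; n = 0 is allowed, as it has
   to be for an irreducible m. *)
Definition factorization (A : idomainType) (E : lmodType A)
    (m : E) (s : seq A) (m' : E) : Prop :=
  [/\ forall a, a \in s -> irreducible a,
      irreducible_in m' &
      m = (\prod_(a <- s) a) *: m'].

Definition same_factors (A : idomainType) (s1 s2 : seq A) : Prop :=
  exists t : seq A,
    [/\ perm_eq t s2, size s1 = size t &
        forall i, (i < size s1)%N -> associates s1`_i t`_i].

Definition factorial_module (A : idomainType) (E : lmodType A) : Prop :=
  [/\ torsion_free E,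
      forall m : E, m != 0 -> exists s m', factorization m s m' &
      forall (m : E) s1 m1 s2 m2, m != 0 ->
        factorization m s1 m1 -> factorization m s2 m2 ->
        same_factors s1 s2 /\ associates_in m1 m2].

(* For a ~ b iff F a = F b on S: the class of a, as a subset of S, and the set
   of all classes. *)
Definition class_of (T U : Type) (S : set T) (F : T -> U) (a : T) : set T :=
  [set b | S b /\ F b = F a].

Definition EC (T U : Type) (S : set T) (F : T -> U) : set (set T) :=
  class_of S F @` S.

Definition qD_class (A : idomainType) (E : lmodType A) (a : A) : set A :=
  class_of (Wsharp E) (scaled E) a.

Definition qD_EC (A : idomainType) (E : lmodType A) : set (set A) :=
  EC (Wsharp E) (scaled E).

Definition qD_U (A : idomainType) (E : lmodType A) (a : A) : set (set A) :=
  [set qD_class E b | b in [set b | Wsharp E b /\ scaled E a `<=` scaled E b]].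

Definition qD (A : idomainType) (E : lmodType A) : Type := set_type (qD_EC E).

Definition qD_val (A : idomainType) (E : lmodType A) : qD E -> set A :=
  @set_val _ (qD_EC E).

HB.instance Definition _ (A : idomainType) (E : lmodType A) :=
  Choice.copy (qD E) (set_type (qD_EC E)).

Definition qD_base (A : idomainType) (E : lmodType A) : set (set (qD E)) :=
  [set @qD_val A E @^-1` qD_U E a | a in Wsharp E].
Arguments qD_base {A} E _.

Lemma qD_base_cover (A : idomainType) (E : lmodType A) :
  \bigcup_(V in qD_base E) id V = setT.
Proof.
apply/seteqP; split=> // x _.
have [a aW ax] : qD_EC E (qD_val x) by exact: set_mem (valP x).
exists (@qD_val A E @^-1` qD_U E a); first by exists a.
by exists a; first by split.
Qed.

Lemma qD_base_join (A : idomainType) (E : lmodType A) (V1 V2 : set (qD E)) x :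
  qD_base E V1 -> qD_base E V2 -> id V1 x -> id V2 x ->
  exists V, [/\ qD_base E V, id V x & id V `<=` id V1 `&` id V2].
Proof.
move=> [a1 _ <-] [a2 _ <-] [b1 [b1W ab1] b1x] [b2 [b2W ab2] b2x].
have b12 : scaled E b1 = scaled E b2.
  have : qD_class E b1 b1 by [].
  by rewrite b1x -b2x => -[].
exists (@qD_val A E @^-1` qD_U E b1); split; [by exists b1|by exists b1; first by split|].
move=> y [c [cW bc] cy]; split; exists c => //; split=> //.
- exact: subset_trans bc.
- by rewrite b12 in bc; exact: subset_trans bc.
Qed.

HB.instance Definition _ (A : idomainType) (E : lmodType A) :=
  isBaseTopological.Build (qD E) (@qD_base_cover A E) (@qD_base_join A E).

Definition Asharp (A : idomainType) : set A :=
  [set a | a != 0 /\ a \isn't a GRing.unit].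
Arguments Asharp : clear implicits.

Definition D_class (A : idomainType) (a : A) : set A :=
  class_of (Asharp A) (@principal A) a.

Definition D_EC (A : idomainType) : set (set A) := EC (Asharp A) (@principal A).
Arguments D_EC : clear implicits.

Definition D_U (A : idomainType) (a : A) : set (set A) :=
  [set D_class b | b in [set b | Asharp A b /\ divides b a]].

Definition D (A : idomainType) : Type := set_type (D_EC A).

Definition D_val (A : idomainType) : D A -> set A := @set_val _ (D_EC A).

HB.instance Definition _ (A : idomainType) :=
  Choice.copy (D A) (set_type (D_EC A)).

Definition D_base (A : idomainType) : set (set (D A)) :=
  [set @D_val A @^-1` D_U a | a in Asharp A].
Arguments D_base : clear implicits.

Lemma divides_refl (A : idomainType) (a : A) : divides a a.
Proof. by exists 1; rewrite mulr1. Qed.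

Lemma divides_trans (A : idomainType) (b a c : A) :
  divides a b -> divides b c -> divides a c.
Proof. by move=> [x ->] [y ->]; exists (x * y); rewrite mulrA. Qed.

Lemma principal_divides (A : idomainType) (a b : A) :
  principal a = principal b -> divides a b.
Proof.
move=> ab; have : principal b b by exists 1; rewrite ?mulr1.
by rewrite -ab => -[c _ <-]; exists c.
Qed.

Lemma D_base_cover (A : idomainType) : \bigcup_(V in D_base A) id V = setT.
Proof.
apply/seteqP; split=> // x _.
have [a aA ax] : D_EC A (D_val x) by exact: set_mem (valP x).
exists (@D_val A @^-1` D_U a); first by exists a.
by exists a => //; split=> //; exact: divides_refl.
Qed.

Lemma D_base_join (A : idomainType) (V1 V2 : set (D A)) x :
  D_base A V1 -> D_base A V2 -> id V1 x -> id V2 x ->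
  exists V, [/\ D_base A V, id V x & id V `<=` id V1 `&` id V2].
Proof.
move=> [a1 _ <-] [a2 _ <-] [b1 [b1A ab1] b1x] [b2 [b2A ab2] b2x].
have b12 : divides b1 b2.
  apply: principal_divides; have : D_class b1 b1 by [].
  by rewrite b1x -b2x => -[].
exists (@D_val A @^-1` D_U b1); split; [by exists b1| |].
  by exists b1 => //; split=> //; exact: divides_refl.
move=> y [c [cA cb] cy]; split; exists c => //; split=> //.
- exact: divides_trans ab1.
- exact: divides_trans (divides_trans cb b12) ab2.
Qed.

HB.instance Definition _ (A : idomainType) :=
  isBaseTopological.Build (D A) (@D_base_cover A) (@D_base_join A).

Definition homeomorphic (X Y : topologicalType) : Prop :=
  exists (f : X -> Y) (g : Y -> X),
    [/\ cancel f g, cancel g f, continuous f & continuous g].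

(* The points of both spaces are subsets of A; the two topologies are compared
   as families of sets of such subsets. *)
Definition qD_topology (A : idomainType) (E : lmodType A) : set (set (set A)) :=
  [set @qD_val A E @` O | O in @open (qD E)].

Definition D_topology (A : idomainType) : set (set (set A)) :=
  [set @D_val A @` O | O in @open (D A)].
Arguments D_topology : clear implicits.

(* Main.v *)
Require Import Defs.
From mathcomp Require Import all_boot all_algebra.
From mathcomp Require Import all_classical topology.

(** Both spaces are described by the divisibility preorder on a set of elements
    of [A]: on [Wsharp E], ordered by inclusion of the submodules [aE], for the
    one, and on [Asharp A], ordered by divisibility, for the other.  It is
    enough to see that the two sets and the two preorders agree; the classes,
    the basic open sets and hence the topologies are then literally equal.

    Since [E] is not second it is not zero, so it contains a nonzero [m0]
    irreducible in [E].  A nonzero nonunit [a] cannot satisfy [aE = E], for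
    [m0 = a m'] would make [a] a unit; with torsion freeness this gives
    [Wsharp E = Asharp A] ([WsharpE]).

    For the preorders, let [aE] be contained in [bE] with [a] nonzero, and
    write [a m0 = b n], [n = r n'] with [n'] irreducible.  If [m0] and [n'] are
    associates, cancelling them gives that [b] divides [a]
    ([scaled_subset_divides]).  They are the irreducible parts of
    factorizations of the same element, provided [a] and [b] themselves are
    products of irreducibles.  This atomicity of [A] is read off from [E]
    ([atomic]): multiplication by a nonunit strictly increases the number of
    irreducible factors of a nonzero element of [E] ([ltn_factors_scale]), so a
    proper factor [c] of [a] gives a [c m0] with fewer factors than [a m0], and
    splitting [a] terminates.

    Equality of the topologies yields the homeomorphism: both spaces are
    subtypes of the subsets of [A], and matching points with equal underlying
    subsets is bicontinuous ([homeomorphic_embedded]). *)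

Set Implicit Arguments.
Unset Strict Implicit.
Unset Printing Implicit Defensive.

Import GRing.Theory.
Local Open Scope classical_set_scope.
Local Open Scope ring_scope.

(** * Factorizations in a factorial module *)

Section FactorialModule.
Variables (A : idomainType) (E : lmodType A).
Hypothesis E_factorial : factorial_module E.

Lemma scaler_neq0 (a : A) (m : E) : a != 0 -> m != 0 -> a *: m != 0.
Proof.
have [tf _ _] := E_factorial; move=> a0 m0; apply/eqP => /tf[] /eqP.
- by rewrite (negbTE a0).
- by rewrite (negbTE m0).
Qed.

Lemma scaler_injl (a b : A) (m : E) : m != 0 -> a *: m = b *: m -> a = b.
Proof.
move=> m0 /eqP; rewrite -subr_eq0 -scalerBl => abm.
apply/eqP; rewrite -subr_eq0; apply: contraLR abm => ab0.
exact: scaler_neq0.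
Qed.

Lemma irreducible_in_unit (u : A) (m : E) :
  u \is a GRing.unit -> irreducible_in m -> irreducible_in (u *: m).
Proof.
move=> uU mi a m' umE.
have : m = (u^-1 * a) *: m' by rewrite -scalerA -umE scalerA mulVr ?scale1r.
by move/mi; rewrite unitrMr ?unitrV.
Qed.

Lemma factorization_scale (c : A) (m m' m'' : E) (s t : seq A) :
  factorization m s m' -> factorization (c *: m') t m'' ->
  factorization (c *: m) (s ++ t) m''.
Proof.
move=> [si _ ->] [ti m''i cmE]; split=> //.
  by move=> a; rewrite mem_cat => /orP[/si|/ti].
by rewrite scalerA mulrC -scalerA cmE scalerA big_cat.
Qed.

Lemma size_factorization (m m1 m2 : E) (s1 s2 : seq A) : m != 0 ->
  factorization m s1 m1 -> factorization m s2 m2 -> size s1 = size s2.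
Proof.
have [_ _ uniq_fact] := E_factorial; move=> m0 f1 f2.
have [[t [ts2 -> _]] _] := uniq_fact _ _ _ _ _ m0 f1 f2.
exact: perm_size.
Qed.

(** If [m = p m'] with [m'] irreducible, then [c m'] is not irreducible, so it
    contributes at least one factor on top of those of [p]. *)
Lemma ltn_factors_scale (c : A) (m m1 m2 : E) (s t : seq A) :
  c != 0 -> c \isn't a GRing.unit -> m != 0 ->
  factorization m s m1 -> factorization (c *: m) t m2 -> (size s < size t)%N.
Proof.
have [_ ex_fact _] := E_factorial; move=> c0 cNU m0 fm fcm.
have m10 : m1 != 0.
  by apply: contraNneq m0 => m1E; case: fm => _ _ ->; rewrite m1E scaler0.
have [r [m3 fr]] := ex_fact _ (scaler_neq0 c0 m10).
rewrite (size_factorization (scaler_neq0 c0 m0) fcm (factorization_scale fm fr)).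
rewrite size_cat -[ltnLHS]addn0 ltn_add2l lt0n size_eq0.
apply: contra cNU => /eqP r0.
case: fr => _ m3i; rewrite r0 big_nil scale1r => cm1E.
exact: (m3i c m1).
Qed.

(** The number of factors of [a m] is the measure that makes splitting [a] into
    nonunits terminate. *)
Lemma atomic (a : A) (m : E) : m != 0 -> a != 0 ->
  exists (s : seq A) (u : A), [/\ forall p, p \in s -> irreducible p,
    u \is a GRing.unit & a = \prod_(p <- s) p * u].
Proof.
have [_ ex_fact _] := E_factorial; move=> m0 a0.
have [t [m' fam]] := ex_fact _ (scaler_neq0 a0 m0).
have [n] := ubnP (size t); elim: n => // n IHn in a a0 t m' fam *.
rewrite ltnS => tn.
have [aU|aNU] := boolP (a \is a GRing.unit).
  by exists [::], a; split=> //; rewrite big_nil mul1r.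
have [ai|aNi] := pselect (irreducible a).
  exists [:: a], 1; rewrite unitr1 big_seq1 mulr1; split=> // p.
  by rewrite inE => /eqP ->.
have [b [c [abc bNU cNU]]] : exists b c : A,
    [/\ a = b * c, b \isn't a GRing.unit & c \isn't a GRing.unit].
  apply: contrapT => Nbc; apply: aNi; split=> // b c abc.
  have [|bNU] := boolP (b \is a GRing.unit); first by left.
  have [|cNU] := boolP (c \is a GRing.unit); first by right.
  by exfalso; apply: Nbc; exists b, c.
have b0 : b != 0 by apply: contraNneq a0 => b0; rewrite abc b0 mul0r.
have c0 : c != 0 by apply: contraNneq a0 => c0; rewrite abc c0 mulr0.
have split_factor d e : a = d * e -> d \isn't a GRing.unit -> d != 0 -> e != 0 ->
    exists (s : seq A) (u : A), [/\ forall p, p \in s -> irreducible p,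
      u \is a GRing.unit & e = \prod_(p <- s) p * u].
  move=> ade dNU d0 e0; have em0 := scaler_neq0 e0 m0.
  have [r [m'' fr]] := ex_fact _ em0.
  apply: (IHn _ e0 _ _ fr); apply: leq_trans tn.
  by apply: (ltn_factors_scale d0 dNU em0 fr (m2 := m')); rewrite scalerA -ade.
have [s [u [si uU cE]]] := split_factor b c abc bNU b0 c0.
have [r [v [ri vU bE]]] := split_factor c b (etrans abc (mulrC _ _)) cNU c0 b0.
exists (r ++ s), (v * u); split; last by rewrite abc bE cE big_cat mulrACA.
  by move=> p; rewrite mem_cat => /orP[/ri|/si].
by rewrite unitrM vU.
Qed.

(** The irreducible part of an element is unchanged by scalars, since these are
    themselves products of irreducibles. *)
Lemma irreducible_part_scale (a b : A) (m m' : E) : m != 0 -> a != 0 ->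
  irreducible_in m -> irreducible_in m' -> a *: m = b *: m' ->
  exists w : A, m' = w *: m.
Proof.
have [_ _ uniq_fact] := E_factorial; move=> m0 a0 mi m'i amE.
have am0 := scaler_neq0 a0 m0.
have b0 : b != 0 by apply: contraNneq am0 => b0; rewrite amE b0 scale0r.
have [s [u [si uU aE]]] := atomic m0 a0.
have [t [v [ti vU bE]]] := atomic m0 b0.
have fa : factorization (a *: m) s (u *: m).
  by split=> //; [exact: irreducible_in_unit|rewrite aE scalerA].
have fb : factorization (a *: m) t (v *: m').
  by split=> //; [exact: irreducible_in_unit|rewrite amE bE scalerA].
have [_ [w _ vm'E]] := uniq_fact _ _ _ _ _ am0 fa fb.
by exists (v^-1 * (w * u)); rewrite -scalerA -scalerA -vm'E scalerA mulVr ?scale1r.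
Qed.

(** The zero module is second, so there is a nonzero element to factor, and its
    irreducible part will do. *)
Lemma exists_irreducible_in :
  ~ second E -> exists2 m : E, m != 0 & irreducible_in m.
Proof.
have [_ ex_fact _] := E_factorial; move=> E_not_second.
have [m m0] : exists m : E, m != 0.
  apply: contrapT => E0; apply: E_not_second => a; left.
  apply/seteqP; split=> // x _; exists 0 => //.
  by rewrite scaler0; apply/esym/eqP; apply: contrapT => /negP x0; apply: E0; exists x.
have [s [m' [_ m'i mE]]] := ex_fact _ m0.
by exists m' => //; apply: contraNneq m0 => m'0; rewrite mE m'0 scaler0.
Qed.

(** * Divisibility read off from the submodules aE *)

Hypothesis E_not_second : ~ second E.

Lemma divides_scaled_subset (a b : A) :
  divides b a -> scaled E a `<=` scaled E b.
Proof.
by move=> [c ->] _ [m _ <-]; exists (c *: m) => //; rewrite scalerA.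
Qed.

(** One test element suffices: for [m] irreducible, [a m] lies in [bE] only if
    the irreducible part of its quotient by [b] is a multiple of [m], and then
    [m] cancels. *)
Lemma scaled_subset_divides (a b : A) : a != 0 ->
  scaled E a `<=` scaled E b -> divides b a.
Proof.
have [_ ex_fact _] := E_factorial; move=> a0 ab.
have [m m0 mi] := exists_irreducible_in E_not_second.
have am0 := scaler_neq0 a0 m0.
have [n _ bnE] : scaled E b (a *: m) by apply: ab; exists m.
have n0 : n != 0 by apply: contraNneq am0 => n0; rewrite -bnE n0 scaler0.
have [s [n' [_ n'i nE]]] := ex_fact _ n0.
have amE : a *: m = (b * \prod_(p <- s) p) *: n' by rewrite -bnE nE scalerA.
have [w n'E] := irreducible_part_scale m0 a0 mi n'i amE.
exists (\prod_(p <- s) p * w); apply: (scaler_injl m0).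
by rewrite amE n'E scalerA mulrA.
Qed.

Lemma WsharpE : Wsharp E = Asharp A.
Proof.
have [m m0 mi] := exists_irreducible_in E_not_second.
apply/seteqP; split=> a /=.
- move=> [aW aN]; split.
    apply: contra_notN aN => /eqP ->; apply/seteqP; split=> x /=.
      by move=> [y _ <-]; rewrite scale0r.
    by move=> ->; exists 0 => //; rewrite scaler0.
  apply: contra_notN aW => aU; apply/seteqP; split=> // x _.
  by exists (a^-1 *: x) => //; rewrite scalerA divrr ?scale1r.
- move=> [a0 aNU]; split=> /= aE.
    have [m' _ amE] : scaled E a m by rewrite aE.
    by move: aNU; rewrite (mi a m').
  have : scaled E a (a *: m) by exists m.
  by rewrite aE => /= /eqP; rewrite (negbTE (scaler_neq0 a0 m0)).
Qed.

Lemma scaled_principal (a b : A) : Asharp A a -> Asharp A b ->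
  scaled E a = scaled E b <-> principal a = principal b.
Proof.
move=> [a0 _] [b0 _]; split=> ab.
  apply/seteqP; split=> _ [c _ <-].
    have [d ->] : divides b a by apply: scaled_subset_divides; rewrite ?ab.
    by exists (d * c) => //; rewrite mulrA.
  have [d ->] : divides a b by apply: scaled_subset_divides; rewrite ?ab.
  by exists (d * c) => //; rewrite mulrA.
by apply/seteqP; split; apply: divides_scaled_subset; apply: principal_divides.
Qed.

Lemma qD_classE (a : A) : Asharp A a -> qD_class E a = D_class a.
Proof.
move=> aA; rewrite /qD_class /D_class /class_of WsharpE.
by apply/seteqP; split=> b [bA ab]; split=> //; apply/scaled_principal.
Qed.

Lemma qD_ECE : qD_EC E = D_EC A.
Proof. by apply: etrans (eq_imagel qD_classE); rewrite -WsharpE. Qed.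

Lemma qD_UE (a : A) : Asharp A a -> qD_U E a = D_U a.
Proof.
move=> [a0 _]; rewrite /qD_U /D_U.
have -> : [set b | Wsharp E b /\ scaled E a `<=` scaled E b] =
          [set b | Asharp A b /\ divides b a].
  rewrite WsharpE; apply/seteqP; split=> b [bA ab]; split=> //.
    exact: scaled_subset_divides.
  exact: divides_scaled_subset.
by apply: eq_imagel => b [bA _]; exact: qD_classE.
Qed.

End FactorialModule.

(** * Topologies as families of sets of classes *)

(** Images commute with unions, and the image of a basic open set [v @^-1` U] is
    [U] itself, because [U] consists of values of [v]. *)
Lemma image_topology_base (X Y : Type) (v : X -> Y) (B : set (set Y)) :
  (forall U, B U -> U `<=` range v) ->
  [set v @` O | O in [set \bigcup_(V in F) V |
    F in subset^~ [set v @^-1` U | U in B]]] =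
  [set \bigcup_(U in F) U | F in subset^~ B].
Proof.
move=> Bv; have vK U : B U -> v @` (v @^-1` U) = U.
  move=> BU; apply/seteqP; split; first exact: image_preimage_subset.
  by move=> y Uy; have [x _ xy] := Bv _ BU _ Uy; exists x; rewrite /preimage/= ?xy.
apply/seteqP; split=> [_ [_ [F FB <-] <-]|_ [F FB <-]].
  rewrite image_bigcup; exists [set v @` V | V in F]; last exact: bigcup_image.
  by move=> _ [V /FB[U BU <-] <-]; rewrite vK.
exists (\bigcup_(V in [set v @^-1` U | U in F]) V).
  by exists [set v @^-1` U | U in F] => // _ [U /FB BU <-]; exists U.
rewrite bigcup_image image_bigcup; apply: eq_bigcupr => U /FB; exact: vK.
Qed.

(** If [f] respects embeddings of [X] and [Y] in [U], the preimage of [O] under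
    [f] and the set [O] have the same image in [U]. *)
Lemma continuous_embedded (X Y : topologicalType) (U : Type)
    (i : X -> U) (j : Y -> U) (f : X -> Y) : injective i -> injective j ->
  (forall x, j (f x) = i x) ->
  [set j @` O | O in @open Y] `<=` [set i @` O | O in @open X] ->
  continuous f.
Proof.
move=> i_inj j_inj fE ijO; apply/continuousP => O oO.
have [O' oO' O'E] : [set i @` O | O in @open X] (j @` O).
  by apply: ijO; exists O.
suff -> : f @^-1` O = O' by [].
apply/seteqP; split=> x /= Ox.
  have : (j @` O) (i x) by exists (f x).
  by rewrite -O'E => -[x' O'x' /i_inj <-].
have : (i @` O') (i x) by exists x.
by rewrite O'E => -[y Oy]; rewrite -fE => /j_inj <-.
Qed.

(** The homeomorphism sends a point of [X] to the point of [Y] with the same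
    image in [U]. *)
Lemma homeomorphic_embedded (X Y : topologicalType) (U : Type)
    (i : X -> U) (j : Y -> U) : injective i -> injective j ->
  range i = range j ->
  [set i @` O | O in @open X] = [set j @` O | O in @open Y] ->
  homeomorphic X Y.
Proof.
move=> i_inj j_inj ijR ijO.
have ij x : exists y, j y = i x.
  have : range i (i x) by exists x.
  by rewrite ijR => -[y _ yx]; exists y.
have ji y : exists x, i x = j y.
  have : range j (j y) by exists y.
  by rewrite -ijR => -[x _ xy]; exists x.
have [f fE] := choice ij; have [g gE] := choice ji.
exists f, g; split.
- by move=> x; apply: i_inj; rewrite gE fE.
- by move=> y; apply: j_inj; rewrite fE gE.
- by apply: (continuous_embedded i_inj j_inj fE); rewrite ijO.
- by apply: (continuous_embedded j_inj i_inj gE); rewrite ijO.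
Qed.

Lemma range_qD_val (A : idomainType) (E : lmodType A) :
  range (@qD_val A E) = qD_EC E.
Proof.
apply/seteqP; split=> [_ [x _ <-]|x xE]; first exact: set_valP.
by exists (exist _ x (mem_set xE)).
Qed.

Lemma range_D_val (A : idomainType) : range (@D_val A) = D_EC A.
Proof.
apply/seteqP; split=> [_ [x _ <-]|x xE]; first exact: set_valP.
by exists (exist _ x (mem_set xE)).
Qed.

Lemma qD_topologyE (A : idomainType) (E : lmodType A) :
  qD_topology E =
  [set \bigcup_(U in F) U | F in subset^~ [set qD_U E a | a in Wsharp E]].
Proof.
rewrite -(@image_topology_base _ _ (@qD_val A E)); last first.
  move=> _ [a _ <-]; rewrite range_qD_val => _ [b [bW _] <-].
  by exists b.
by rewrite (image_comp (@qD_U A E)).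
Qed.

Lemma D_topologyE (A : idomainType) :
  D_topology A =
  [set \bigcup_(U in F) U | F in subset^~ [set D_U a | a in Asharp A]].
Proof.
rewrite -(@image_topology_base _ _ (@D_val A)); last first.
  move=> _ [a _ <-]; rewrite range_D_val => _ [b [bA _] <-].
  by exists b.
by rewrite (image_comp (@D_U A)).
Qed.

Theorem theorem4 (A : idomainType) (E : lmodType A)
    (E_factorial : factorial_module E) (E_not_second : ~ second E) :
  [/\ homeomorphic (qD E) (D A),
      qD_EC E = D_EC A &
      qD_topology E = D_topology A].
Proof.
have EC_eq := qD_ECE E_factorial E_not_second.
have topology_eq : qD_topology E = D_topology A.
  rewrite qD_topologyE D_topologyE WsharpE //.
  by rewrite (eq_imagel (qD_UE E_factorial E_not_second)).
split=> //; apply: (@homeomorphic_embedded _ _ _ (@qD_val A E) (@D_val A)) => //.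
by rewrite range_qD_val range_D_val.
Qed.
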